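(* Let $G = G_a$ be the additive algebraic group, so that $G(\mathbb{Z}) = \mathbb{Z}$ and $G(\mathbb{R}) = \mathbb{R}$. Then, as formal Dirichlet series, $$\zeta_G(s) = \frac{\zeta(s)^2}{\zeta(2s)},$$ where $\zeta_G$ is the commensurability zeta function of $G$ and $\zeta$ is the Riemann zeta function.
   Context: For subgroups $\Delta_1,\Delta_2$ of $G(\mathbb{R})$, the commensurability index is $\mathrm{c}(\Delta_1,\Delta_2) := [\Delta_1:\Delta_1\cap\Delta_2]\,[\Delta_2:\Delta_1\cap\Delta_2]$; the two subgroups are commensurable if this is finite. An arithmetic lattice in $G$ is a subgroup of $G(\mathbb{R})$ commensurable with $G(\mathbb{Z})$. Let $\mathcal{L}(G)$ be the set of all arithmetic lattices in $G$ and $\mathbf{c}_n(\mathcal{L}(G)) := |\{\Delta\in\mathcal{L}(G) : \mathrm{c}(G(\mathbb{Z}),\Delta)=n\}|$. The commensurability zeta function is the Dirichlet series $\zeta_G(s) := \sum_{n=1}^\infty \mathbf{c}_n(\mathcal{L}(G))\, n^{-s}$. *)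

(* Defs.v *)
From mathcomp Require Import all_boot all_order all_algebra.
From mathcomp Require Import finmap.
From mathcomp Require Import boolp classical_sets cardinality.
From mathcomp Require Import reals constructive_ereal.

Set Implicit Arguments.
Unset Strict Implicit.
Unset Printing Implicit Defensive.
Import Order.TTheory GRing.Theory Num.Theory.
Local Open Scope classical_set_scope.
Local Open Scope ring_scope.

(* The ambient group is written additively, as for G_a(R) = (R, +). *)
Section Commensurability.
Variable V : zmodType.
Implicit Types D H : set V.

Definition subgroup D : Prop := GRing.zmod_closed (fun x => x \in D).

Definition cosets D H : set (set V) := [set [set x + h | h in H] | x in D].

Definition index D H : \bar int :=
  if `[< finite_set (cosets D H) >] then (#|` fset_set (cosets D H)|%:Z)%:E
  else +oo%E.

Definition comm_index D1 D2 : \bar int :=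
  (index D1 (D1 `&` D2) * index D2 (D1 `&` D2))%E.

Definition commensurable D1 D2 : Prop := (comm_index D1 D2 < +oo)%E.

(* In the next definitions, [Gamma] plays the role of G(Z). *)
Definition arithmetic_lattices (Gamma : set V) : set (set V) :=
  [set D | subgroup D /\ commensurable D Gamma].

Definition lattices_of_index (Gamma : set V) (n : nat) : set (set V) :=
  arithmetic_lattices Gamma `&` [set D | comm_index Gamma D = (n%:Z)%:E].

(* [fset_set] sends infinite sets to the empty one, so this is a count only
   when [lattices_of_index Gamma n] is finite. *)
Definition num_lattices (Gamma : set V) (n : nat) : nat :=
  #|` fset_set (lattices_of_index Gamma n)|.

End Commensurability.

(* [f : dirichlet K] stands for the formal series \sum_(n >= 1) f n * n^-s;
   the value [f 0] is irrelevant. *)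
Definition dirichlet (K : comUnitRingType) : Type := nat -> K.

Section Dirichlet.
Variable K : comUnitRingType.
Implicit Types f g : dirichlet K.

Definition dirichlet_eq f g : Prop := forall n, (0 < n)%N -> f n = g n.

Definition dirichlet_one : dirichlet K := fun n => (n == 1)%:R.

Definition dirichlet_mul f g : dirichlet K :=
  fun n => \sum_(d <- divisors n) f (n %/ d)%N * g d.

(* The inverse of a series whose leading coefficient [f 1] is a unit, obtained
   by solving [dirichlet_mul f g = dirichlet_one] coefficient by coefficient;
   [k >= n] is fuel for the recursion. *)
Fixpoint dirichlet_inv_rec f (k n : nat) : K :=
  if k is k'.+1 then
    (f 1)^-1 * ((n == 1)%:R -
      \sum_(d <- divisors n | (d < n)%N) f (n %/ d)%N * dirichlet_inv_rec f k' d)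
  else 0.

Definition dirichlet_inv f : dirichlet K := fun n => dirichlet_inv_rec f n n.

Definition dirichlet_div f g : dirichlet K := dirichlet_mul f (dirichlet_inv g).

(* For k > 0, the series f(k s) = \sum_(m >= 1) f m * (m ^ k)^-s. *)
Definition dirichlet_dilate (k : nat) f : dirichlet K :=
  fun n => \sum_(1 <= m < n.+1 | (m ^ k == n)%N) f m.

Lemma dirichlet_inv_rec_eq f k n : (0 < n <= k)%N ->
  dirichlet_inv_rec f k n = dirichlet_inv f n.
Proof.
suff gen m : forall k1 k2, (0 < m)%N -> (m <= k1)%N -> (m <= k2)%N ->
    dirichlet_inv_rec f k1 m = dirichlet_inv_rec f k2 m.
  by move=> /andP[n0 nk]; apply: gen.
have [p] := ubnP m; elim: p m => // p IHp m mp [|k1] [|k2] m0 mk1 mk2;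
  rewrite ?leqn0 in mk1 mk2; try by move: m0; rewrite ?(eqP mk1) ?(eqP mk2).
rewrite /=; congr (_ * (_ - _)).
rewrite big_seq_cond [RHS]big_seq_cond; apply: eq_bigr => d /andP[dm dltm].
congr (_ * _); apply: IHp.
- exact: leq_trans dltm mp.
- by move: dm; rewrite -dvdn_divisors// => /dvdn_gt0; apply.
- by rewrite -ltnS (leq_trans dltm).
- by rewrite -ltnS (leq_trans dltm).
Qed.

Lemma dirichlet_mulV f : f 1 \is a GRing.unit ->
  dirichlet_eq (dirichlet_mul f (dirichlet_inv f)) dirichlet_one.
Proof.
move=> f1 [//|n] _; rewrite /dirichlet_mul.
rewrite (bigD1_seq n.+1) ?divisors_uniq -?dvdn_divisors//= divnn/=.
rewrite {1}/dirichlet_inv /= mulVKr// /dirichlet_one.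
suff -> : \sum_(d <- divisors n.+1 | (d < n.+1)%N)
    f (n.+1 %/ d)%N * dirichlet_inv_rec f n d =
  \sum_(d <- divisors n.+1 | d != n.+1) f (n.+1 %/ d)%N * dirichlet_inv f d.
  by rewrite subrK.
rewrite big_seq_cond [RHS]big_seq_cond; apply: eq_big => [d|d /andP[dn dltn]].
  apply: andb_id2l; rewrite -dvdn_divisors// => /dvdn_leq => /(_ isT) dle.
  by rewrite ltn_neqAle dle andbT.
rewrite dirichlet_inv_rec_eq//; apply/andP; split; last by rewrite -ltnS.
by move: dn; rewrite -dvdn_divisors// => /dvdn_gt0; apply.
Qed.

End Dirichlet.

Definition riemann_zeta : dirichlet int := fun=> 1.

Definition comm_zeta (V : zmodType) (Gamma : set V) : dirichlet int :=
  fun n => (num_lattices Gamma n)%:Z.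

Definition Ga_Z (R : realType) : set R := [set z%:~R | z in [set: int]].
Arguments Ga_Z : clear implicits.

(* Main.v *)
(* An arithmetic lattice D in R has D / (D meet Z) of finite exponent, so it lies
   in (1/N) Z and equals (a/b) Z for coprime positive a, b. Its intersection with
   Z is a Z, of index a in Z and of index b in D, so lattices of index n
   correspond to the unitary divisors a of n, that is, those coprime to n / a.
   Sorting the factorizations n = x y by m = gcd(x, y) leaves a coprime
   factorization of n / m ^ 2; hence the series counting unitary divisors, times
   zeta(2 s), is zeta(s) ^ 2. *)

From mathcomp Require Import all_boot all_order all_algebra finmap.
From mathcomp Require Import boolp classical_sets cardinality reals.
From mathcomp Require Import constructive_ereal.
From mathcomp Require Import ring zify.
(* Last, so that [index] is the subgroup index rather than [seq.index]. *)
Require Import Defs.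

Set Implicit Arguments.
Unset Strict Implicit.
Unset Printing Implicit Defensive.
Import Order.TTheory GRing.Theory Num.Theory.
Local Open Scope ring_scope.

Lemma big_pred1_seq (M : Type) (idx : M) (op : Monoid.law idx) (I : eqType)
    (r : seq I) (i : I) (F : I -> M) : uniq r -> i \in r ->
  \big[op/idx]_(j <- r | j == i) F j = F i.
Proof. by move=> ur ir; rewrite -big_filter filter_pred1_uniq// big_seq1. Qed.

(** * The convolution algebra of formal Dirichlet series *)

Section DirichletAlgebra.
Variable K : comUnitRingType.
Implicit Types f g h : dirichlet K.

(** Summing over a full square of pairs makes the ranges independent of divisibility, and the free
    bound [N] lets nested convolutions share one range. For fixed [j] only [i = n / j]
    contributes. *)
Lemma dirichlet_mulE f g (N n : nat) : (0 < n < N)%N ->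
  dirichlet_mul f g n =
  \sum_(i < N) \sum_(j < N) f i * g j *+ (i * j == n)%N.
Proof.
move=> /andP[n0 nN]; rewrite exchange_big/=.
transitivity (\sum_(0 <= d < N | (d %| n)%N) f (n %/ d)%N * g d).
  rewrite -[RHS]big_filter; apply: perm_big; apply: uniq_perm.
  - exact: divisors_uniq.
  - by rewrite filter_uniq// iota_uniq.
  - move=> d; rewrite mem_filter -dvdn_divisors// mem_index_iota/=.
    by case: (boolP (d %| n)%N) => // /(dvdn_leq n0) dn; rewrite (leq_ltn_trans dn).
rewrite big_mkord big_mkcond; apply: eq_bigr => j _.
case: ifPn => [jn|jn]; last first.
  rewrite big1// => i _; case: eqP => // ijn.
  by move: jn; rewrite -ijn dvdn_mull.
have j0 : (0 < j)%N by apply: dvdn_gt0 jn.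
have qN : (n %/ j < N)%N by apply: leq_ltn_trans nN; exact: leq_div.
rewrite (bigD1 (Ordinal qN))//= divnK// eqxx big1 ?addr0// => i.
rewrite -val_eqE/= => iq; case: eqP => // ijn.
by move: iq; rewrite -ijn mulnK// eqxx.
Qed.

Lemma eq_dirichlet_mul f f' g g' : dirichlet_eq f f' -> dirichlet_eq g g' ->
  dirichlet_eq (dirichlet_mul f g) (dirichlet_mul f' g').
Proof.
move=> ff' gg' n n0; rewrite /dirichlet_mul big_seq [RHS]big_seq.
apply: eq_bigr => d; rewrite -dvdn_divisors// => dn.
have d0 := dvdn_gt0 n0 dn.
by rewrite ff' ?gg'// divn_gt0// dvdn_leq.
Qed.

Lemma dirichlet_mulr1 f : dirichlet_eq (dirichlet_mul f (dirichlet_one K)) f.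
Proof.
move=> n n0; rewrite /dirichlet_mul (bigD1_seq 1%N) ?divisor1 ?divisors_uniq//=.
rewrite divn1 /dirichlet_one eqxx mulr1 big1 ?addr0// => d /negbTE ->.
by rewrite mulr0.
Qed.

(** Both sides equal the triple sum over [i * j * k = n]. *)
Lemma dirichlet_mulA f g h :
  dirichlet_eq (dirichlet_mul f (dirichlet_mul g h))
               (dirichlet_mul (dirichlet_mul f g) h).
Proof.
move=> n n0; have nN : (0 < n < n.+1)%N by rewrite n0 /=.
(* Factors of [n] are positive, so the inner convolutions are never expanded at 0, where
   [dirichlet_mulE] does not apply. *)
have pos a b : (a * b)%N = n -> (0 < a)%N && (0 < b)%N.
  by rewrite -muln_gt0 => ->.
(* Eliminates the intermediate product [a = m]; the hypothesis on [p] keeps [m] in range whenever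
   its term is nonzero. *)
have collapse (x : K) (m : nat) (p : pred nat) :
    (forall a, p a -> (a < n.+1)%N) ->
    \sum_(a < n.+1) x *+ (m == a) *+ p a = x *+ p m.
  move=> pn; case: (boolP (p m)) => [pm|npm].
    rewrite (bigD1 (Ordinal (pn _ pm)))//= eqxx pm big1 ?addr0// => a.
    by rewrite -val_eqE/= eq_sym => /negbTE ->; rewrite mul0rn.
  rewrite big1// => a _; case: eqP => [<-|]; last by rewrite mul0rn.
  by rewrite (negbTE npm).
rewrite !(dirichlet_mulE _ _ nN).
transitivity (\sum_(i < n.+1) \sum_(j < n.+1) \sum_(k < n.+1)
    f i * g j * h k *+ (i * j * k == n)%N).
  apply: eq_bigr => i _.
  transitivity (\sum_(a < n.+1) \sum_(j < n.+1) \sum_(k < n.+1)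
      f i * g j * h k *+ (j * k == a)%N *+ (i * a == n)%N).
    apply: eq_bigr => a _; case: eqP => [ian|_]; last first.
      by rewrite mulr0n big1// => j _; rewrite big1.
    rewrite mulr1n (@dirichlet_mulE _ _ n.+1); last first.
      by rewrite ltn_ord andbT; have /andP[] := pos _ _ ian.
    rewrite mulr_sumr; apply: eq_bigr => j _.
    by rewrite mulr_sumr; apply: eq_bigr => k _; rewrite mulr1n mulrnAr mulrA.
  rewrite exchange_big/=; apply: eq_bigr => j _.
  rewrite exchange_big/=; apply: eq_bigr => k _.
  rewrite (collapse _ _ (fun a => i * a == n)%N) ?mulnA//.
  move=> a /eqP ian; rewrite ltnS -ian leq_pmull//.
  by have /andP[] := pos _ _ ian.
symmetry; transitivity (\sum_(a < n.+1) \sum_(k < n.+1) \sum_(i < n.+1)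
    \sum_(j < n.+1) f i * g j * h k *+ (i * j == a)%N *+ (a * k == n)%N).
  apply: eq_bigr => a _; apply: eq_bigr => k _.
  case: eqP => [akn|_]; last first.
    by rewrite mulr0n big1// => j _; rewrite big1.
  rewrite mulr1n (@dirichlet_mulE _ _ n.+1); last first.
    by rewrite ltn_ord andbT; have /andP[] := pos _ _ akn.
  rewrite mulr_suml; apply: eq_bigr => i _.
  by rewrite mulr_suml; apply: eq_bigr => j _; rewrite mulr1n mulrnAl.
rewrite exchange_big/=.
transitivity (\sum_(k < n.+1) \sum_(i < n.+1) \sum_(j < n.+1)
    f i * g j * h k *+ (i * j * k == n)%N).
  apply: eq_bigr => k _; rewrite exchange_big/=; apply: eq_bigr => i _.
  rewrite exchange_big/=; apply: eq_bigr => j _.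
  rewrite (collapse _ _ (fun a => a * k == n)%N)//.
  move=> a /eqP akn; rewrite ltnS -akn leq_pmulr//.
  by have /andP[] := pos _ _ akn.
rewrite exchange_big/=; apply: eq_bigr => i _.
by rewrite exchange_big.
Qed.

Lemma dirichlet_divP f g h : g 1%N \is a GRing.unit ->
  dirichlet_eq (dirichlet_mul f g) h -> dirichlet_eq f (dirichlet_div h g).
Proof.
move=> g1 fgh n n0; rewrite -[LHS]dirichlet_mulr1//.
rewrite -(eq_dirichlet_mul (f := f) (fun _ _ => erefl) (dirichlet_mulV g1))//.
by rewrite dirichlet_mulA//; exact: eq_dirichlet_mul.
Qed.

(** Since [m ^ k = d] forces [m <= d], the bound can be raised to one common to all divisors [d] of
    [n], which allows the sums over [d] and [m] to be exchanged below. *)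
Lemma dirichlet_dilateE (k : nat) f (d N : nat) : (0 < k)%N -> (0 < d < N)%N ->
  dirichlet_dilate k f d = \sum_(1 <= m < N | (m ^ k == d)%N) f m.
Proof.
move=> k0 /andP[d0 dN]; rewrite /dirichlet_dilate (big_nat_widen _ _ N)//.
rewrite big_nat_cond [RHS]big_nat_cond; apply: eq_bigl => m.
case: eqP => [<-|]; rewrite ?andbF//= ltnS.
case: (boolP (0 < m < N)%N) => //= /andP[m0 _].
by rewrite -[leqLHS]expn1 leq_pexp2l.
Qed.

Lemma dirichlet_mul_dilateE (k : nat) f g (n : nat) : (0 < k)%N -> (0 < n)%N ->
  dirichlet_mul f (dirichlet_dilate k g) n =
  \sum_(1 <= m < n.+1 | (m ^ k %| n)%N) f (n %/ m ^ k)%N * g m.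
Proof.
move=> k0 n0; rewrite /dirichlet_mul.
transitivity (\sum_(d <- divisors n) \sum_(1 <= m < n.+1 | (m ^ k == d)%N)
    f (n %/ m ^ k)%N * g m).
  rewrite big_seq [RHS]big_seq; apply: eq_bigr => d.
  rewrite -dvdn_divisors// => dn.
  rewrite (@dirichlet_dilateE k g d n.+1)// ?mulr_sumr; last first.
    by rewrite ltnS (dvdn_leq n0 dn) (dvdn_gt0 n0 dn).
  by apply: eq_bigr => m /eqP ->.
rewrite (exchange_big_dep xpredT)//= [RHS]big_mkcond/=; apply: eq_bigr => m _.
rewrite dvdn_divisors//; case: ifPn => [mn|mn].
  rewrite (eq_bigl (fun d => d == m ^ k)%N) => [|d]; last by rewrite eq_sym.
  by rewrite big_pred1_seq ?divisors_uniq.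
rewrite big_seq_cond big1// => d /andP[dn /eqP mkd].
by rewrite -mkd (negbTE mn) in dn.
Qed.
End DirichletAlgebra.

(** * Unitary divisors and their generating series *)

Definition unitary_divisors (n : nat) : seq nat :=
  [seq d <- divisors n | coprime d (n %/ d)].

Lemma mem_unitary_divisors n d : (0 < n)%N ->
  (d \in unitary_divisors n) = (d %| n)%N && coprime d (n %/ d).
Proof. by move=> n0; rewrite mem_filter andbC dvdn_divisors. Qed.

Definition unitary_count : dirichlet int :=
  fun n => (size (unitary_divisors n))%:Z.

(* A divisor d of n is m * a for a unique m and a unique unitary divisor a of
   n / m ^ 2, namely m = gcd(d, n / d). *)
Lemma divisors_of_gcd (n m : nat) : (0 < n)%N -> (0 < m)%N ->
  perm_eq [seq d <- divisors n | gcdn d (n %/ d) == m]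
          (if (m ^ 2 %| n)%N then
             [seq (m * a)%N | a <- unitary_divisors (n %/ m ^ 2)]
           else [::]).
Proof.
move=> n0 m0; apply: uniq_perm.
- by rewrite filter_uniq// divisors_uniq.
- case: ifP => // _; rewrite map_inj_uniq ?filter_uniq ?divisors_uniq//.
  by move=> a b /eqP; rewrite eqn_pmul2l// => /eqP.
move=> d; rewrite mem_filter -dvdn_divisors//.
(* If [m] is the gcd of [d] and [n / d], it divides both, so [m ^ 2] divides [n]; otherwise the
   class is empty. *)
case: ifPn => [/dvdnP[q nq]|m2n]; last first.
  rewrite in_nil; apply/negP => /andP[/eqP gm /dvdnP[e nde]].
  move: gm m2n; have d0 : (0 < d)%N by move: n0; rewrite nde muln_gt0 => /andP[].
  rewrite nde mulnK// => <-; rewrite -mulnn.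
  by rewrite dvdn_mul// ?dvdn_gcdl ?dvdn_gcdr.
have q0 : (0 < q)%N by move: n0; rewrite nq muln_gt0 => /andP[].
have m2 : (0 < m ^ 2)%N by rewrite expn_gt0 m0.
rewrite nq mulnK//; apply/idP/idP.
  move=> /andP[/eqP gm /dvdnP[e nde]].
  have d0 : (0 < d)%N by move: n0; rewrite nq nde muln_gt0 => /andP[].
  rewrite nde mulnK// in gm.
  (* With [d = a * m] and [n / d = b * m], the quotient [n / m ^ 2] is [a * b], and cancelling [m]
     in the gcd leaves [a] and [b] coprime. *)
  have /dvdnP[a da] : (m %| d)%N by rewrite -gm dvdn_gcdl.
  have /dvdnP[b eb] : (m %| e)%N by rewrite -gm dvdn_gcdr.
  have a0 : (0 < a)%N by move: d0; rewrite da muln_gt0 => /andP[].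
  have qab : q = (a * b)%N.
    by apply/eqP; rewrite -(eqn_pmul2r m2) nde da eb -mulnn; apply/eqP; ring.
  rewrite da mulnC map_f// mem_unitary_divisors// qab dvdn_mulr// mulKn//=.
  by rewrite /coprime -(eqn_pmul2r m0) muln_gcdl -da -eb gm mul1n.
move=> /mapP[a]; rewrite mem_unitary_divisors// => /andP[/dvdnP[b qba]] cop ->.
have a0 : (0 < a)%N by move: q0; rewrite qba muln_gt0 => /andP[].
rewrite qba mulnK// in cop *.
have -> : (b * a * m ^ 2 = (b * m) * (m * a))%N by rewrite -mulnn; ring.
rewrite dvdn_mull// mulnK ?muln_gt0 ?m0// (mulnC b) -muln_gcdr.
by rewrite (eqP cop) muln1 eqxx.
Qed.

Lemma unitary_count_mul_squares :
  dirichlet_eq (dirichlet_mul unitary_count (dirichlet_dilate 2 riemann_zeta))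
               (dirichlet_mul riemann_zeta riemann_zeta).
Proof.
move=> n n0; rewrite dirichlet_mul_dilateE// /dirichlet_mul.
transitivity (\sum_(1 <= m < n.+1)
    \sum_(d <- divisors n | gcdn d (n %/ d) == m) 1 : int).
  rewrite big_mkcond/= big_nat [RHS]big_nat; apply: eq_bigr => m /andP[m0 _].
  rewrite -[in RHS]big_filter (perm_big _ (divisors_of_gcd n0 m0)).
  case: ifP => _; last by rewrite big_nil.
  by rewrite big_map big_const_seq count_predT iter_addr_0 mulr1 natz.
(* Each divisor [d] lies in exactly one gcd class, whose label is between 1 and [n], so it is
   counted once. *)
rewrite (exchange_big_dep xpredT)//= big_seq [RHS]big_seq; apply: eq_bigr => d.
rewrite -dvdn_divisors// => dn; have d0 := dvdn_gt0 n0 dn.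
rewrite (eq_bigl (fun m => m == gcdn d (n %/ d))) => [|m]; last by rewrite eq_sym.
rewrite big_pred1_seq ?iota_uniq// mem_index_iota gcdn_gt0 d0/= ltnS.
by rewrite (leq_trans (dvdn_leq d0 (dvdn_gcdl _ _)))// dvdn_leq.
Qed.

Lemma unitary_count_zeta :
  dirichlet_eq unitary_count
    (dirichlet_div (dirichlet_mul riemann_zeta riemann_zeta)
                   (dirichlet_dilate 2 riemann_zeta)).
Proof.
apply: dirichlet_divP unitary_count_mul_squares.
(* The leading coefficient of zeta(2 s) is 1, hence a unit. *)
by rewrite /dirichlet_dilate big_mkcond big_nat1.
Qed.

(** * Subgroups, cosets and indices *)

Local Open Scope classical_set_scope.

(** The lower bounds exclude the convention [0 * +oo = 0], under which a finite product could hide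
    an infinite index. *)
Lemma mul_lt_pinfty (x y : \bar int) : (1 <= x)%E -> (1 <= y)%E ->
  (x * y < +oo)%E -> (x < +oo)%E /\ (y < +oo)%E.
Proof.
move=> x1 y1; have x0 : (0 < x)%E by apply: lt_le_trans x1.
have y0 : (0 < y)%E by apply: lt_le_trans y1.
case: x x1 x0 => [x| |]//; case: y y1 y0 => [y| |]// y1 y0 x1 x0.
- by rewrite !ltry.
- by rewrite gt0_muley.
- by rewrite gt0_mulye.
Qed.

Section Subgroups.
Variable V : zmodType.
Implicit Types (D H : set V) (x y : V).

Definition coset x H : set V := [set x + h | h in H].

Section Closure.
Variables (D : set V) (sD : subgroup D).

Lemma subgroup0 : D 0.
Proof. by case: sD => /set_mem. Qed.

Lemma subgroupB x y : D x -> D y -> D (x - y).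
Proof.
by case: sD => _ Bclosed /mem_set xD /mem_set yD; apply: set_mem; apply: Bclosed.
Qed.

Lemma subgroupN x : D x -> D (- x).
Proof. by move=> xD; rewrite -sub0r; apply: subgroupB => //; apply: subgroup0. Qed.

Lemma subgroupD x y : D x -> D y -> D (x + y).
Proof. by move=> xD yD; rewrite -(opprK y); apply/subgroupB/subgroupN. Qed.

Lemma subgroupMn x n : D x -> D (x *+ n).
Proof.
move=> xD; elim: n => [|n IHn]; first exact: subgroup0.
by rewrite mulrS; apply: subgroupD.
Qed.

Lemma subgroupMz x z : D x -> D (x *~ z).
Proof.
case: z => n xD; first exact: subgroupMn.
by rewrite NegzE mulrNz; apply/subgroupN/subgroupMn.
Qed.

Lemma eq_coset x y : coset x D = coset y D <-> D (x - y).
Proof.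
split=> [xy|Dxy].
  have : coset x D x by exists 0; [apply: subgroup0|rewrite addr0].
  by rewrite xy => -[h Dh <-]; rewrite addrC addKr.
apply/seteqP; split=> _ [h Dh <-].
- by exists (x - y + h); [apply: subgroupD|rewrite addrA addrCA subrr addr0].
- exists (h - (x - y)); first exact: subgroupB.
  by rewrite opprB addrCA subrKC addrC.
Qed.

End Closure.

Lemma subgroupI D H : subgroup D -> subgroup H -> subgroup (D `&` H).
Proof.
move=> sD sH; split; first by apply: mem_set; split; apply: subgroup0.
move=> x y /set_mem[xD xH] /set_mem[yD yH]; apply: mem_set.
by split; apply: subgroupB.
Qed.

Lemma index_card D H k : (cosets D H #= `I_k)%card -> index D H = (k%:Z)%:E.
Proof.
move=> DHk; rewrite /index asboolT; last by apply/finite_setP; exists k.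
by rewrite (card_fset_set DHk).
Qed.

Lemma index_lt_pinfty D H :
  (index D H < +oo)%E -> exists k, (cosets D H #= `I_k)%card.
Proof.
by rewrite /index; case: asboolP => // /finite_setP.
Qed.

Lemma index_ge1 D H : subgroup D -> (1 <= index D H)%E.
Proof.
move=> sD; rewrite /index; case: asboolP => [fin|_]; last exact: leey.
rewrite lee_fin lez_nat cardfs_gt0; apply/negP => /eqP/(congr1 (fun A => [set` A])).
rewrite fset_setK// set_fset0 => /seteqP[/(_ (coset 0 H))/= abs _].
by apply: abs; exists 0 => //; apply: subgroup0.
Qed.

Lemma comm_indexC D H : comm_index D H = comm_index H D.
Proof. by rewrite /comm_index setIC muleC. Qed.

(* Among x, 2x, ..., (k + 1)x two are congruent modulo H if D/H has k elements;
   hence k! kills D/H. *)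
Lemma finite_index_exponent D H : subgroup D -> subgroup H ->
  (index D H < +oo)%E ->
  exists2 N, (0 < N)%N & forall x, D x -> H (x *+ N).
Proof.
move=> sD sH /index_lt_pinfty[k cDH]; exists k`! => [|x Dx]; first exact: fact_gt0.
pose f i := coset (x *+ i) H.
have fD : f @` `I_k.+1 `<=` cosets D H.
  by move=> _ [i _ <-]; exists (x *+ i) => //; exact: subgroupMn.
have [i [j [ij jk fij]]] : exists i j, [/\ (i < j)%N, (j <= k)%N & f i = f j].
  apply: contrapT => ninj.
  have finj : {in `I_k.+1 &, injective f}.
    move=> i j /set_mem/= ik /set_mem/= jk fij; apply/eqP.
    have [ltij|ltji|//] := ltngtP i j; case: ninj.
    - by exists i, j.
    - by exists j, i.
  have := subset_card_le fD.
  rewrite (card_le_eql (inj_card_eq finj)) (card_le_eqr cDH) card_le_II.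
  by rewrite ltnn.
have Hij : H (x *+ (j - i)).
  by rewrite mulrnBr ?(ltnW ij)//; apply/(eq_coset sH).
(* The difference [j - i] lies between 1 and [k]. *)
have /dvdnP[q ->] : (j - i %| k`!)%N.
  by rewrite dvdn_fact// subn_gt0 ij/= (leq_trans (leq_subr _ _)).
by rewrite mulnC mulrnA; apply: subgroupMn.
Qed.

Definition multiples x : set V := [set x *~ z | z in [set: int]].

Lemma subgroup_multiples x : subgroup (multiples x).
Proof.
split; first by apply: mem_set; exists 0; rewrite ?mulr0z.
move=> _ _ /set_mem[z _ <-] /set_mem[t _ <-]; apply: mem_set.
by exists (z - t); rewrite // mulrzBr.
Qed.

(** Euclidean division by [k] gives the coset representatives 0, x, ..., (k - 1) x, and freeness of
    [x] keeps their cosets distinct. *)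
Lemma index_multiples x k : (forall z : int, x *~ z = 0 -> z = 0) -> (0 < k)%N ->
  index (multiples x) (multiples (x *+ k)) = (k%:Z)%:E.
Proof.
move=> x_free k0; apply: index_card.
have k0z : k%:Z != 0 by lia.
pose f i := coset (x *+ i) (multiples (x *+ k)).
have -> : cosets (multiples x) (multiples (x *+ k)) = f @` `I_k.
  apply/seteqP; split=> [_ [_ [z _ <-] <-]|_ [y yk <-]].
  - exists `|(z %% k)%Z|%N.
      by rewrite /= -ltz_nat gez0_abs ?modz_ge0// ltz_pmod// ltz_nat.
    apply/(eq_coset (subgroup_multiples _)); exists (- (z %/ k)%Z) => //.
    rewrite !pmulrn -!mulrzA -mulrzBr gez0_abs ?modz_ge0//; congr (_ *~ _).
    by rewrite {3}(divz_eq z k); ring.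
  - by exists (x *+ y) => //; exists y%:Z; rewrite ?pmulrn.
apply: inj_card_eq => i j /set_mem/= ik /set_mem/= jk.
move=> /(eq_coset (subgroup_multiples _))[z _].
rewrite !pmulrn -mulrzA -mulrzBr => /esym/eqP; rewrite -subr_eq0 -mulrzBr.
move=> /eqP/x_free ijkz.
(* The difference of [i] and [j] is [k * z] but smaller than [k] in absolute value, so [z = 0]. *)
have z1 : z < 1 by rewrite ltNge; apply/negP => ?; nia.
have zN1 : -1 < z by rewrite ltNge; apply/negP => ?; nia.
have z0 : z = 0 by lia.
by move: ijkz; rewrite z0 mulr0; lia.
Qed.

End Subgroups.

(** * Arithmetic lattices in the real line *)

Section RealLattices.
Variable R : realType.
Implicit Types (D : set R) (a b n : nat) (x y : R).

Lemma Ga_Z_multiples : Ga_Z R = multiples 1.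
Proof. by []. Qed.

Lemma multiples_free x : x != 0 -> forall z : int, x *~ z = 0 -> z = 0.
Proof.
by move=> x0 z /eqP; rewrite mulrz_eq0 (negbTE x0) orbF => /eqP.
Qed.

(** Each generator is an integer multiple of the other; by positivity both multipliers are positive,
    and their product is 1. *)
Lemma multiples_inj x y : 0 < x -> 0 < y -> multiples x = multiples y -> x = y.
Proof.
move=> x0 y0 xy.
have [z _ zx] : multiples y x by rewrite -xy; exists 1.
have [t _ ty] : multiples x y by rewrite xy; exists 1.
have z0 : 0 < z by move: x0; rewrite -zx pmulrz_rgt0.
have t0 : 0 < t by move: y0; rewrite -ty pmulrz_rgt0.
have : y *~ (z * t - 1) = 0 by rewrite mulrzBr mulrzA zx ty subrr.
move=> /(multiples_free (lt0r_neq0 y0)) zt.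
by rewrite -zx (_ : z = 1)//; nia.
Qed.

Lemma comm_index_multiples a b : (0 < a)%N -> (0 < b)%N -> coprime a b ->
  comm_index (Ga_Z R) (multiples (a%:R / b%:R)) = ((a * b)%N%:Z)%:E.
Proof.
move=> a0 b0 cab; have aR : a%:R != 0 :> R by rewrite pnatr_eq0 -lt0n.
have bR : b%:R != 0 :> R by rewrite pnatr_eq0 -lt0n.
have abK : (a%:R / b%:R) *+ b = a%:R :> R by rewrite -mulr_natr divfK.
(* The intersection is generated by [a], which is [a] times the generator 1 and [b] times the
   generator [a / b]; both indices then come from [index_multiples]. *)
have ->: comm_index (Ga_Z R) (multiples (a%:R / b%:R)) =
    (index (multiples (1 : R)) (multiples (1 *+ a)) *
     index (multiples (a%:R / b%:R : R)) (multiples ((a%:R / b%:R) *+ b)))%E.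
  rewrite abK /comm_index Ga_Z_multiples.
  suff -> : multiples 1 `&` multiples (a%:R / b%:R) = multiples (a%:R : R) by [].
  apply/seteqP; split=> [y [[z _ <-] [t _]]|_ [z _ <-]].
    rewrite -[LHS]mulrzr mulrAC => /(canRL (divfK bR)) tazb.
    have {}tazb : a%:Z * t = z * b%:Z.
      by apply: (intr_inj (R := R)); rewrite !intrM.
    (* Coprimality turns [a * t = z * b] into divisibility of [t] by [b], so that [z] is a multiple
       of [a]. *)
    have /dvdzP[q tq] : (b%:Z %| t)%Z.
      by rewrite -(@Gauss_dvdzr _ a%:Z) ?tazb ?dvdz_mull// coprimezE coprime_sym.
    exists q => //; rewrite -[LHS]mulrzr -[1 *~ z]/(z%:~R : R).
    have -> : z = a%:Z * q by nia.
    by rewrite intrM.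
  split; first by exists (a%:Z * z); rewrite // mulrzA.
  by exists (b%:Z * z); rewrite // mulrzA -pmulrn abK.
rewrite !index_multiples//; first exact/multiples_free/mulf_neq0/invr_neq0.
exact/multiples_free/oner_neq0.
Qed.

(** Finiteness of the index in [D] bounds the denominators by some [N], and finiteness of the index
    in Z gives [D] a positive element. The least positive [k] with [k / N] in [D] then yields a
    generator. *)
Lemma arithmetic_latticesP D : arithmetic_lattices (Ga_Z R) D ->
  exists a b, [/\ (0 < a)%N, (0 < b)%N, coprime a b &
    D = multiples (a%:R / b%:R)].
Proof.
move=> [sD]; rewrite /commensurable /comm_index => fin.
have sZ : subgroup (Ga_Z R) by exact: subgroup_multiples.
have sI := subgroupI sD sZ.
have [finD finZ] := mul_lt_pinfty (index_ge1 _ sD) (index_ge1 _ sZ) fin.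
have [N N0 DN] := finite_index_exponent sD sI finD.
have [M M0 ZM] := finite_index_exponent sZ sI finZ.
have NR : N%:R != 0 :> R by rewrite pnatr_eq0 -lt0n.
have exk : exists k, (0 < k)%N && `[< D (k%:R / N%:R) >].
  (* Here [M * N / N = M], which lies in [D] because [M] kills Z modulo its intersection with
     [D]. *)
  exists (M * N)%N; rewrite muln_gt0 M0 N0/=; apply/asboolP.
  by rewrite natrM mulfK//; apply: (ZM 1 _).1; exists 1.
case: (ex_minnP exk) => k /andP[k0 /asboolP Dk] kmin.
have kN : D = multiples (k%:R / N%:R).
  apply/seteqP; split=> [x Dx|_ [z _ <-]]; last exact: subgroupMz.
  have [_ [z _]] := DN x Dx.
  rewrite -[RHS]mulr_natr => /esym/(canRL (mulfK NR)) xz.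
  (* Subtracting a multiple of [k / N] from [x = z / N] leaves [r / N] in [D] with [r < k], so
     [r = 0] by minimality of [k]. *)
  have rk : (`|(z %% k)%Z| < k)%N.
    by rewrite -ltz_nat gez0_abs ?modz_ge0 ?ltz_pmod; lia.
  have zE : z = (z %/ k)%Z * k%:Z + `|(z %% k)%Z|%N%:Z.
    by rewrite gez0_abs ?modz_ge0 -?divz_eq//; lia.
  have xE : x - (k%:R / N%:R) *~ (z %/ k)%Z = `|(z %% k)%Z|%N%:R / N%:R.
    rewrite xz {1}zE -mulrzr intrD intrM !pmulrn; field.
    exact: NR.
  have Dr : D (`|(z %% k)%Z|%N%:R / N%:R).
    by rewrite -xE; apply: subgroupB => //; apply: subgroupMz.
  have r0 : `|(z %% k)%Z|%N = 0%N.
    apply/eqP; rewrite -leqn0 leqNgt; apply/negP => r0.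
    have := kmin `|(z %% k)%Z|%N; rewrite r0 asboolT// => /(_ isT).
    by rewrite leqNgt rk.
  exists (z %/ k)%Z => //; apply/esym/eqP; rewrite -subr_eq0 xE r0.
  by rewrite mul0r.
have g0 : (0 < gcdn k N)%N by rewrite gcdn_gt0 k0.
exists (k %/ gcdn k N)%N, (N %/ gcdn k N)%N; split.
- by rewrite divn_gt0// dvdn_leq// dvdn_gcdl.
- by rewrite divn_gt0// dvdn_leq// dvdn_gcdr.
- by rewrite /coprime -(eqn_pmul2r g0) muln_gcdl !divnK ?dvdn_gcdl ?dvdn_gcdr// mul1n.
- have gR : (gcdn k N)%:R != 0 :> R by rewrite pnatr_eq0 -lt0n.
  rewrite kN -{1}(divnK (dvdn_gcdl k N)) -{3}(divnK (dvdn_gcdr k N)) !natrM.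
  by rewrite -mulf_div divff// mulr1.
Qed.

(** Once the index [n = a * b] is fixed, the numerator [a = d] determines the denominator. *)
Definition unitary_lattice n d : set R := multiples (d%:R / (n %/ d)%:R).

Lemma unitary_lattice_inj n : (0 < n)%N ->
  {in unitary_divisors n &, injective (unitary_lattice n)}.
Proof.
move=> n0 d e; rewrite !mem_unitary_divisors// => /andP[dn _] /andP[en _].
have d0 := dvdn_gt0 n0 dn; have e0 := dvdn_gt0 n0 en.
have qd0 : (0 < n %/ d)%N by rewrite divn_gt0// dvdn_leq.
have qe0 : (0 < n %/ e)%N by rewrite divn_gt0// dvdn_leq.
move=> /multiples_inj; rewrite !divr_gt0 ?ltr0n// => /(_ isT isT)/eqP.
rewrite eqr_div ?pnatr_eq0 -?lt0n// -!natrM eqr_nat => /eqP.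
move: (divnK dn) (divnK en) => dK eK deq.
(* The generator is [d ^ 2 / n], so equal generators have equal squares [d ^ 2] and [e ^ 2]. *)
have : (d ^ 2 * n = e ^ 2 * n)%N.
  have -> : (d ^ 2 * n = d * (n %/ e) * (d * e))%N by rewrite -{1}eK; ring.
  by rewrite deq -{2}dK; ring.
by move=> /eqP; rewrite eqn_pmul2r// eqn_exp2r// => /eqP.
Qed.

Lemma lattices_of_indexE n : (0 < n)%N ->
  lattices_of_index (Ga_Z R) n = unitary_lattice n @` [set` unitary_divisors n].
Proof.
move=> n0; apply/seteqP; split=> [D [/arithmetic_latticesP]|_ [d /= dn <-]].
  move=> [a [b [a0 b0 cab ->]]]; rewrite /= comm_index_multiples// => -[abn].
  have qb : (n %/ a)%N = b by rewrite -abn mulKn.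
  exists a; last by rewrite /unitary_lattice qb.
  by rewrite /= mem_unitary_divisors// qb cab -abn dvdn_mulr.
move: dn; rewrite mem_unitary_divisors// => /andP[dn cop].
have ci : comm_index (Ga_Z R) (unitary_lattice n d) = (n%:Z)%:E.
  rewrite comm_index_multiples// ?(dvdn_gt0 n0 dn)//.
    by rewrite mulnC divnK.
  by rewrite divn_gt0 ?(dvdn_gt0 n0 dn)// dvdn_leq.
split=> //; split; first exact: subgroup_multiples.
by rewrite /commensurable comm_indexC ci ltry.
Qed.

Lemma card_lattices_of_index n : (0 < n)%N ->
  (lattices_of_index (Ga_Z R) n #= `I_(size (unitary_divisors n)))%card.
Proof.
move=> n0; rewrite lattices_of_indexE//.
(* Positions in the duplicate-free list give the bijection with an initial segment. *)
have -> : [set` unitary_divisors n] =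
    nth 0%N (unitary_divisors n) @` `I_(size (unitary_divisors n)).
  apply/seteqP; split=> [d /= /(nthP 0%N)[i]|_ [i /= ? <-]]; last exact: mem_nth.
  by exists i.
rewrite image_comp; apply: inj_card_eq => i j /set_mem/= iu /set_mem/= ju.
move=> /(unitary_lattice_inj n0) ij; apply/eqP.
rewrite -(nth_uniq 0%N iu ju) ?filter_uniq ?divisors_uniq//.
by apply/eqP/ij; apply: mem_nth.
Qed.

End RealLattices.

(* The first conjunct says that the coefficients of the commensurability zeta
   function are finite, so that it is a well-defined Dirichlet series. *)
Theorem proposition1p1 (R : realType) :
  (forall n : nat, (0 < n)%N -> finite_set (lattices_of_index (Ga_Z R) n)) /\
  dirichlet_eq
    (comm_zeta (Ga_Z R))
    (dirichlet_div (dirichlet_mul riemann_zeta riemann_zeta)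
                   (dirichlet_dilate 2 riemann_zeta)).
Proof.
split=> n n0; first by apply/finite_setP; eexists; exact: card_lattices_of_index.
rewrite -unitary_count_zeta// /comm_zeta /num_lattices.
(* The set is finite, so [fset_set] does not fall back to its empty default and the coefficient is a
   true count. *)
by rewrite (card_fset_set (card_lattices_of_index R n0)).
Qed.
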